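(* The following twelve mesh patterns $(12,R)$ are pairwise equidistributed, where $R$ ranges over: $\{(1,2),(2,2),(0,1)\}$, $\{(1,2),(0,1),(0,0)\}$, $\{(2,2),(2,1),(1,0)\}$, $\{(2,1),(1,0),(0,0)\}$, $\{(2,2),(0,1),(1,1)\}$, $\{(1,2),(1,1),(0,0)\}$, $\{(1,1),(2,1),(0,0)\}$, $\{(2,2),(1,1),(1,0)\}$, $\{(1,2),(2,2),(0,0)\}$, $\{(2,2),(0,1),(0,0)\}$, $\{(2,2),(2,1),(0,0)\}$, $\{(2,2),(0,0),(1,0)\}$.
   Context: For $R\subseteq\{0,1,2\}^2$ and $\pi=\pi_1\cdots\pi_n\in S_n$, an occurrence of the mesh pattern $(12,R)$ in $\pi$ is a pair of positions $i_1<i_2$ with $\pi_{i_1}<\pi_{i_2}$ such that, setting $x_0=0,x_1=i_1,x_2=i_2,x_3=n+1$ and $y_0=0,y_1=\pi_{i_1},y_2=\pi_{i_2},y_3=n+1$, for every $(a,b)\in R$ there is no index $k$ with $x_a<k<x_{a+1}$ and $y_b<\pi_k<y_{b+1}$. $s_{n,k}(p)$ is the number of $\pi\in S_n$ with exactly $k$ occurrences of $p$; $p_1,p_2$ are equidistributed if $s_{n,k}(p_1)=s_{n,k}(p_2)$ for all $n,k\ge 0$. *)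

(* Defs.v *)
From mathcomp Require Import all_boot all_fingroup.

Set Implicit Arguments.
Unset Strict Implicit.
Unset Printing Implicit Defensive.

(* A permutation pi of {1, .., n} is an s : 'S_n acting on {0, .., n-1}: the
   1-based position of i : 'I_n is i.+1, and its 1-based value is (s i).+1. *)

(* The cell (a, b): a is the column (positions), b is the row (values). *)
Notation "'⟦' a , b '⟧'" :=
  ((@Ordinal 3 a isT, @Ordinal 3 b isT) : 'I_3 * 'I_3)
  (at level 0, a constr, b constr, format "'⟦' a ,  b '⟧'").

(* The grid lines 0, u, v, n+1 (x_0, .., x_3 or y_0, .., y_3), u and v being
   given by their 0-based representatives. *)
Definition grid (n : nat) (u v : 'I_n) (a : nat) : nat :=
  nth 0 [:: 0; u.+1; v.+1; n.+1] a.

Definition in_cell (n : nat) (s : 'S_n) (i j : 'I_n) (c : 'I_3 * 'I_3)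
    (k : 'I_n) : bool :=
  [&& grid i j c.1 < k.+1, k.+1 < grid i j c.1.+1,
      grid (s i) (s j) c.2 < (s k).+1 & (s k).+1 < grid (s i) (s j) c.2.+1].

Definition mesh12_occ (R : {set 'I_3 * 'I_3}) (n : nat) (s : 'S_n)
    (i j : 'I_n) : bool :=
  [&& i < j, s i < s j & [forall c in R, ~~ [exists k, in_cell s i j c k]]].

Definition mesh12_count (R : {set 'I_3 * 'I_3}) (n : nat) (s : 'S_n) : nat :=
  #|[set ij : 'I_n * 'I_n | mesh12_occ R s ij.1 ij.2]|.

Definition mesh12_snk (R : {set 'I_3 * 'I_3}) (n k : nat) : nat :=
  #|[set s : 'S_n | mesh12_count R s == k]|.

Definition equidistributed (R1 R2 : {set 'I_3 * 'I_3}) : Prop :=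
  forall n k : nat, mesh12_snk R1 n k = mesh12_snk R2 n k.

(* Main.v *)
Require Import Defs.
From mathcomp Require Import all_boot all_fingroup zify.

Set Implicit Arguments.
Unset Strict Implicit.
Unset Printing Implicit Defensive.

(* Transposing (inverse permutation) and rotating by 180 degrees
   (reverse-complement) the mesh splits the twelve patterns into three classes,
   represented by the shadings {22,10,00}, {22,11,10} and {21,10,00}.

   The first two are equinumerous on every permutation: both count the
   right-to-left maxima that are not left-to-right minima.

   For the first and the third, read the permutation from left to right.  An
   occurrence (i, j) forces i to carry the least letter m read before j, and j
   then scores iff its letter is the largest (first pattern), respectively the
   smallest (third pattern), among the letters above m not yet read.  Either way
   exactly one of the letters still available above m scores, so both statistics
   obey the same recursion in the number of letters left and the number of those
   below m. *)

(** * Counting letters of a duplicate-free sequence *)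

Lemma count_singleton (T : eqType) (P : pred T) (s : seq T) (x0 : T) :
  uniq s -> x0 \in s -> P x0 -> {in s, forall x, P x -> x = x0} ->
  count P s = 1.
Proof.
move=> us sx0 Px0 Pu; rewrite (@eq_in_count _ _ (pred1 x0)).
  by rewrite count_uniq_mem ?sx0.
by move=> x sx /=; apply/idP/eqP => [/(Pu _ sx)|->].
Qed.

Lemma count_lt_strict (S : seq nat) (x y : nat) :
  x \in S -> x < y -> count (gtn x) S < count (gtn y) S.
Proof.
move=> Sx ltxy.
have -> : count (gtn y) S =
    count (gtn x) S + count (fun z => x <= z < y) S.
  rewrite -count_predUI [X in _ + X](eq_count (a2 := pred0)) ?count_pred0.
    by rewrite addn0; apply: eq_count => z /=; lia.
  by move=> z /=; lia.
by rewrite -addn1 leq_add2l -has_count; apply/hasP; exists x => //; lia.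
Qed.

(** Ranks in [S] strictly increase with the letter, so the letters below [m] have distinct ranks,
    all less than the rank of [m]. By cardinality these ranks fill the whole initial segment. *)
Lemma sum_count_lt (S : seq nat) (m : nat) (g : nat -> nat) : uniq S ->
  \sum_(x <- S | x < m) g (count (gtn x) S) = \sum_(a < count (gtn m) S) g a.
Proof.
move=> uS; rewrite -(big_mkord xpredT) /index_iota subn0 -big_filter.
rewrite -(big_map (fun x => count (gtn x) S) xpredT); apply: perm_big.
have uC : uniq [seq count (gtn x) S | x <- S & x < m].
  rewrite map_inj_in_uniq ?filter_uniq // => x y.
  rewrite !mem_filter => /andP[_ Sx] /andP[_ Sy] eqxy.
  by case: (ltngtP x y) => [/(count_lt_strict Sx)|/(count_lt_strict Sy)|//];
    rewrite eqxy ltnn.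
apply: uniq_perm; rewrite ?iota_uniq //.
set C := map _ _ in uC *; set I := iota _ _.
have sCI : {subset C <= I}.
  move=> _ /mapP[x + ->]; rewrite mem_filter => /andP[ltxm Sx].
  by rewrite mem_iota /= count_lt_strict.
have szC : size I <= size C by rewrite size_iota size_map size_filter.
by have [_] := uniq_min_size uC sCI szC.
Qed.

(** * A statistic on words and its recursion *)

Section WordStatistic.

(* [m] is the least letter read so far; reading [x > m] scores when every
   letter still to come satisfies [q m x]. *)
Variable q : nat -> nat -> pred nat.

Fixpoint word_stat (m : nat) (t : seq nat) : nat :=
  if t is x :: t' then
    ((m < x) && all (q m x) t') + word_stat (minn m x) t'
  else 0.

Lemma word_statE (m : nat) (t : seq nat) :
  word_stat m t = \sum_(j < size t)
    ((foldl minn m (take j t) < nth 0 t j)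
     && all (q (foldl minn m (take j t)) (nth 0 t j)) (drop j.+1 t)).
Proof.
elim: t m => [|x t IHt] m /=; first by rewrite big_ord0.
by rewrite big_ord_recl /= drop0 IHt.
Qed.

(* The number of words with statistic [k] on [r] letters, [a] of which are
   below the current minimum. *)
Fixpoint word_num (r a k : nat) : nat :=
  if r is r'.+1 then
    \sum_(i < a) word_num r' i k
    + ((r' - a) * word_num r' a k
       + (if (a <= r') && (0 < k) then word_num r' a k.-1 else 0))
  else k == 0.

Hypothesis one_hit : forall (m : nat) (S : seq nat), uniq S -> m \notin S ->
  count (fun x => (m < x) && all (q m x) (rem x S)) S = has (ltn m) S.

(** Induction on the number of letters, splitting the words by their first letter [x]. If [x < m],
    nothing scores and [x] becomes the minimum; if [x > m], the minimum stays, and [one_hit] says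
    how many such [x] score. *)
Lemma count_word_stat (m : nat) (S : seq nat) (k : nat) :
  uniq S -> m \notin S ->
  count (fun t => word_stat m t == k) (permutations S)
  = word_num (size S) (count (gtn m) S) k.
Proof.
have [r] := ubnP (size S); elim: r => // r IHr in m S k *.
rewrite ltnS leq_eqVlt => /predU1P[szS|]; last exact: IHr.
case: r IHr szS => [|r] IHr szS uS mS.
  by rewrite (size0nil szS) /= addn0 eq_sym.
have S_gt0 : 0 < size S by rewrite szS.
rewrite (seq.permP (permutationsE S_gt0)).
rewrite -sum1_count big_mkcond big_allpairs_dep /= undup_id //.
rewrite (bigID (fun x => x < m)) /=.
have szrem x : x \in S -> size (rem x S) = r by move=> Sx; rewrite size_rem // szS.
rewrite szS /= -(sum_count_lt m (word_num r ^~ k) uS); congr (_ + _).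
  rewrite [LHS]big_seq_cond [RHS]big_seq_cond; apply: eq_bigr => x /andP[Sx ltxm].
  rewrite -big_mkcond sum1_count.
  under eq_count => t do rewrite ltnNge (ltnW ltxm) /= add0n (minn_idPr (ltnW ltxm)).
  (* The new minimum is [x]; deleting [x] itself leaves the number of letters below it unchanged. *)
  rewrite IHr ?szrem ?rem_uniq ?mem_rem_uniq ?inE ?eqxx //.
  by rewrite count_rem Sx /= ltnn subn0.
pose hit x := all (q m x) (rem x S).
(* [F b] counts the completions after a letter above [m], which scores iff [b]. After a score no
   completion has total [0], hence the test on [k]. *)
pose F (b : bool) := if b
  then if 0 < k then word_num r (count (gtn m) S) k.-1 else 0
  else word_num r (count (gtn m) S) k.
have nltE x : x \in S -> ~~ (x < m) = (m < x).
  by move=> Sx; rewrite -leqNgt leq_eqVlt; case: eqP Sx mS => [->->|].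
have -> : \sum_(x <- S | ~~ (x < m))
    \sum_(t <- permutations (rem x S))
      (if word_stat m (x :: t) == k then 1 else 0)
  = \sum_(x <- S | m < x) F (hit x).
  rewrite big_seq_cond [RHS]big_seq_cond; apply: eq_big => [x|x /andP[Sx]].
    by case Sx: (x \in S); rewrite //= nltE.
  rewrite nltE // => ltmx; rewrite -big_mkcond sum1_count.
  rewrite (@eq_in_count _ _ (fun t => hit x + word_stat m t == k)); last first.
    move=> t; rewrite mem_permutations => /perm_all tS /=.
    by rewrite ltmx tS (minn_idPl (ltnW ltmx)).
  have IH k' : count (fun t => word_stat m t == k') (permutations (rem x S))
      = word_num r (count (gtn m) S) k'.
    rewrite IHr ?szrem ?rem_uniq //; last first.
      by apply: contra mS; apply: mem_rem.
    rewrite count_rem Sx.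
    by rewrite /= ltnNge (ltnW ltmx) subn0.
  rewrite /F {F}; case: (hit x); last by rewrite -IH; apply: eq_count => t.
  case: k => [|k]; first by rewrite (eq_count (a2 := pred0)) ?count_pred0.
  by rewrite -IH; apply: eq_count => t.
have hasE : has (ltn m) S = (count (gtn m) S <= r).
  rewrite -ltnS -szS -(count_predC (gtn m)) -addn1 leq_add2l has_count.
  by congr (_ < _); apply: eq_in_count => x Sx /=; rewrite nltE.
have cntH : count (ltn m) S = r.+1 - count (gtn m) S.
  rewrite -szS -(count_predC (gtn m)) addKn.
  by apply: eq_in_count => x Sx /=; rewrite nltE.
have := one_hit uS mS; rewrite hasE => hitE.
(* All letters above [m] but one miss. If there are none, truncated subtraction makes the right side
   [0]. *)
have missE : count (fun x => (m < x) && ~~ hit x) S = r - count (gtn m) S.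
  have : count (ltn m) S = count (fun x => (m < x) && hit x) S
      + count (fun x => (m < x) && ~~ hit x) S.
    rewrite -count_predUI [X in _ + X](eq_count (a2 := pred0)) ?count_pred0.
      by rewrite addn0; apply: eq_count => z /=; case: (m < z); case: hit.
    by move=> z /=; case: (m < z); case: hit.
  by rewrite hitE cntH; case: leqP => /=; lia.
rewrite (bigID hit) /= addnC; congr (_ + _).
  rewrite (eq_bigr (fun=> F false)) => [|x /andP[_ /negPf->] //].
  by rewrite big_const_seq missE iter_addn_0 mulnC.
rewrite (eq_bigr (fun=> F true)) => [|x /andP[_ ->] //].
by rewrite big_const_seq hitE iter_addn_0 /F; case: (_ <= r); case: (0 < k);
  rewrite ?muln1 ?muln0.
Qed.
End WordStatistic.

(** * From permutations to words *)

Lemma foldl_minn_mem (m : nat) (l : seq nat) : foldl minn m l \in m :: l.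
Proof.
elim: l m => [|x l IHl] m /=; first by rewrite inE.
have := IHl (minn m x); rewrite !inE => /predU1P[->|->]; last by rewrite !orbT.
by case: leqP; rewrite eqxx ?orbT.
Qed.

Lemma foldl_minn_le (m : nat) (l : seq nat) :
  {in m :: l, forall x, foldl minn m l <= x}.
Proof.
elim: l m => [|x l IHl] m y /=; first by rewrite inE => /eqP->.
rewrite !inE => y_in; have min_le := IHl (minn m x) (minn m x) (mem_head _ _).
case/or3P: y_in => [/eqP->|/eqP->|yl]; [lia | lia |].
by apply: IHl; rewrite inE yl orbT.
Qed.

(** When the right end determines the left end, the second projection is injective on occurrences,
    so right ends can be counted instead of pairs. *)
Lemma mesh12_count_proj (R : {set 'I_3 * 'I_3}) (n : nat) (s : 'S_n) :
  (forall i i' j, mesh12_occ R s i j -> mesh12_occ R s i' j -> i = i') ->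
  mesh12_count R s = #|[set j | [exists i, mesh12_occ R s i j]]|.
Proof.
move=> occ_inj; rewrite /mesh12_count -(card_in_imset (f := snd)).
  apply: eq_card => j; rewrite inE; apply/imsetP/existsP => [[[i j']]|[i occ_ij]].
    by rewrite inE => ? ->; exists i.
  by exists (i, j); rewrite ?inE.
by move=> [i j] [i' j']; rewrite !inE /= => /occ_inj + + eqj; rewrite -eqj => h /h ->.
Qed.

Definition word_of (n : nat) (s : 'S_n) : seq nat := [seq val (s i) | i <- enum 'I_n].

Lemma size_word_of (n : nat) (s : 'S_n) : size (word_of s) = n.
Proof. by rewrite size_map size_enum_ord. Qed.

Lemma nth_word_of (n : nat) (s : 'S_n) (i : 'I_n) : nth 0 (word_of s) i = s i.
Proof. by rewrite (nth_map i) ?nth_ord_enum ?size_enum_ord. Qed.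

(** [word_of] is injective and both lists have [n!] elements, so inclusion suffices. *)
Lemma word_of_perm (n : nat) :
  perm_eq [seq word_of s | s <- enum 'S_n] (permutations (iota 0 n)).
Proof.
have word_inj : injective (@word_of n).
  by move=> s s' eqw; apply/permP => i; apply: val_inj; rewrite /= -!nth_word_of eqw.
have uW : uniq [seq word_of s | s <- enum 'S_n] by rewrite map_inj_uniq ?enum_uniq.
set W := map _ _ in uW *.
have sub : {subset W <= permutations (iota 0 n)}.
  move=> _ /mapP[s _ ->]; rewrite mem_permutations uniq_perm ?iota_uniq //.
    by rewrite /word_of map_inj_uniq ?enum_uniq // => i j /val_inj/perm_inj.
  move=> k; rewrite mem_iota add0n /=; apply/mapP/idP => [[i _ ->]|ltkn]; first exact: ltn_ord.
  by exists ((s^-1)%g (Ordinal ltkn)); rewrite ?mem_enum ?permKV.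
have szW : size (permutations (iota 0 n)) <= size W.
  by rewrite size_permutations ?iota_uniq // size_iota size_map -cardE card_Sn.
have [_ eqW] := uniq_min_size uW sub szW.
by apply: uniq_perm; rewrite ?permutations_uniq.
Qed.

Section MinimumFirst.

Variables (R : {set 'I_3 * 'I_3}) (q : nat -> nat -> pred nat).

Hypothesis occE : forall (n : nat) (s : 'S_n) (i j : 'I_n),
  mesh12_occ R s i j =
  [&& i < j, s i < s j, [forall k : 'I_n, (k < j) ==> (s i <= s k)]
    & [forall k : 'I_n, (j < k) ==> q (s i) (s j) (s k)]].

(** Letters are at most [n - 1], so the starting value [n] stands for an empty minimum and the first
    letter never scores. An occurrence is determined by its right end, as its left end carries the
    least earlier letter. *)
Lemma mesh12_count_word (n : nat) (s : 'S_n) :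
  mesh12_count R s = word_stat q n (word_of s).
Proof.
rewrite mesh12_count_proj; last first.
  move=> i i' j; rewrite !occE => /and4P[ltij _ /forallP mini _].
  move=> /and4P[lti'j _ /forallP mini' _].
  apply: (@perm_inj _ s); apply: val_inj; apply/eqP; rewrite eqn_leq.
  by rewrite (implyP (mini i')) ?(implyP (mini' i)).
rewrite word_statE size_word_of -sum1dep_card big_mkcond; apply: eq_bigr => j _.
set m := foldl _ _ _.
have pre (k : 'I_n) : k < j -> nat_of_ord (s k) \in take j (word_of s).
  move=> ltkj; rewrite -nth_word_of -(nth_take _ ltkj).
  by rewrite mem_nth // size_take size_word_of ltn_ord.
have min_le (k : 'I_n) : k < j -> m <= s k.
  by move=> ltkj; apply: foldl_minn_le; rewrite inE pre ?orbT.
(* A running minimum other than the initial [n] is a letter already read. *)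
have mP : m < n -> exists2 k : 'I_n, k < j & nat_of_ord (s k) = m.
  move=> ltmn; have := foldl_minn_mem n (take j (word_of s)).
  rewrite -/m inE ltn_eqF //= => /(nthP 0)[k].
  rewrite size_take size_word_of ltn_ord => ltkj eqm.
  exists (Ordinal (ltn_trans ltkj (ltn_ord j))) => //.
  by rewrite -nth_word_of /= -eqm nth_take.
have dropE (p : pred nat) : all p (drop j.+1 (word_of s)) =
    [forall k : 'I_n, (j < k) ==> p (s k)].
  apply/(all_nthP 0)/forallP => [allp k|allp k].
    apply/implyP => ltjk; have := allp (k - j.+1).
    rewrite size_drop size_word_of nth_drop subnKC // nth_word_of; apply.
    by rewrite ltn_sub2r ?(leq_ltn_trans ltjk).
  rewrite size_drop size_word_of => ltk.
  have ltn : j.+1 + k < n by lia.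
  have /implyP := allp (Ordinal ltn); rewrite nth_drop -nth_word_of; apply => /=; lia.
rewrite nth_word_of dropE.
suff -> : [exists i, mesh12_occ R s i j] =
    (m < s j) && [forall k : 'I_n, (j < k) ==> q m (s j) (s k)].
  by case: (_ && _).
apply/existsP/andP => [[i]|[ltmj allq]].
  rewrite occE => /and4P[ltij sij /forallP mini qi].
  suff -> : m = s i by [].
  apply/eqP; rewrite eqn_leq min_le //=.
  have [k ltkj <-] : exists2 k : 'I_n, k < j & nat_of_ord (s k) = m.
    by apply: mP; rewrite (leq_ltn_trans (min_le i ltij)).
  exact: (implyP (mini k)).
have [i ltij eqi] := mP (ltn_trans ltmj (ltn_ord _)).
exists i; rewrite occE ltij eqi ltmj allq andbT; apply/forallP => k.
by apply/implyP => /min_le.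
Qed.

Hypothesis one_hit : forall (m : nat) (S : seq nat), uniq S -> m \notin S ->
  count (fun x => (m < x) && all (q m x) (rem x S)) S = has (ltn m) S.

(** At the start all [n] letters lie below the minimum [n]. The right side is free of [q], so any
    two patterns of this shape are equidistributed. *)
Lemma mesh12_snk_word (n k : nat) : mesh12_snk R n k = word_num n n k.
Proof.
have -> : mesh12_snk R n k =
    count (fun t => word_stat q n t == k) [seq word_of s | s <- enum 'S_n].
  rewrite count_map -sum1_count big_enum_cond /mesh12_snk sum1dep_card.
  by apply: eq_card => s; rewrite !inE /= mesh12_count_word.
rewrite (seq.permP (word_of_perm n)).
rewrite count_word_stat ?iota_uniq ?mem_iota ?ltnn ?andbF // size_iota.
congr word_num; rewrite -[RHS](size_iota 0 n); apply/eqP; rewrite -all_count.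
by apply/allP => x; rewrite mem_iota.
Qed.

End MinimumFirst.

(** * The two scoring conditions *)

Definition below (m x : nat) : pred nat := fun y => y <= x.

Definition outside_gap (m x : nat) : pred nat := fun y => ~~ (m < y < x).

(** The one hit is the maximum of [S], provided some letter exceeds [m]. *)
Lemma one_hit_below (m : nat) (S : seq nat) : uniq S -> m \notin S ->
  count (fun x => (m < x) && all (below m x) (rem x S)) S = has (ltn m) S.
Proof.
move=> uS _; have [/hasP[z Sz ltmz]|/hasPn noS] := boolP (has _ S); last first.
  by rewrite (@eq_in_count _ _ pred0) ?count_pred0 // => x /noS /= /negPf->.
have Sbound y : y \in S -> y <= \max_(i <- S) i by move/leq_bigmax_seq->.
have exS : exists y, y \in S by exists z.
case: (ex_maxnP exS Sbound) => x Sx maxx.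
apply: (@count_singleton _ _ _ x) => //.
  rewrite (leq_trans ltmz) ?maxx //=.
  by apply/allP => y /mem_rem /maxx.
move=> y Sy /andP[_ /allP ally]; apply/eqP; rewrite eqn_leq maxx //=.
have [-> //|neqxy] := eqVneq x y; apply: ally.
by rewrite mem_rem_uniq // inE neqxy.
Qed.

(** The one hit is the least letter of [S] above [m]. *)
Lemma one_hit_outside_gap (m : nat) (S : seq nat) : uniq S -> m \notin S ->
  count (fun x => (m < x) && all (outside_gap m x) (rem x S)) S = has (ltn m) S.
Proof.
move=> uS _; have [/hasP[z Sz ltmz]|/hasPn noS] := boolP (has _ S); last first.
  by rewrite (@eq_in_count _ _ pred0) ?count_pred0 // => x /noS /= /negPf->.
have exS : exists y, (y \in S) && (m < y) by exists z; rewrite Sz.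
case: (ex_minnP exS) => x /andP[Sx ltmx] minx.
apply: (@count_singleton _ _ _ x) => //.
  rewrite ltmx /=; apply/allP => y /mem_rem Sy; rewrite /outside_gap.
  by apply/negP => /andP[ltmy]; rewrite ltnNge minx ?Sy.
move=> y Sy /andP[ltmy /allP ally]; apply/eqP; rewrite eqn_leq minx ?Sy // andbT.
have [-> //|neqxy] := eqVneq x y; rewrite leqNgt; apply/negP => ltxy.
by have := ally x; rewrite mem_rem_uniq // inE neqxy Sx /outside_gap ltmx ltxy => /(_ isT).
Qed.

(** * Symmetries of the mesh *)

Lemma forall_in_imset (T : finType) (f : T -> T) (R : {set T}) (P : pred T) :
  [forall c in f @: R, P c] = [forall c in R, P (f c)].
Proof.
apply/forall_inP/forall_inP => [PfR c Rc | PR _ /imsetP[c Rc ->]]; last exact: PR.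
exact/PfR/imset_f.
Qed.

Lemma card_set_bij (T : finType) (f g : T -> T) (A B : pred T) :
  cancel f g -> cancel g f -> (forall x, A x = B (f x)) ->
  #|[set x | A x]| = #|[set x | B x]|.
Proof.
move=> fK gK eqAB; rewrite -(on_card_preimset (f := f) (R := [set x | B x])).
  by apply: eq_card => x; rewrite !inE eqAB.
by exists g => x _.
Qed.

Definition transpose_cell (c : 'I_3 * 'I_3) := (c.2, c.1).

(** An occurrence [(i, j)] in [s] becomes [(s i, s j)] in the inverse of [s], and a point at
    position [k'] moves to position [s k']. *)
Lemma equidistributed_transpose (R : {set 'I_3 * 'I_3}) :
  equidistributed R (transpose_cell @: R).
Proof.
move=> n k; apply: (card_set_bij invgK invgK) => s; congr (_ == _).
pose f (t : 'S_n) (ij : 'I_n * 'I_n) := (t ij.1, t ij.2).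
apply: (@card_set_bij _ (f s) (f (s^-1)%g)) => [[i j]|[i j]|[i j]] /=.
- by rewrite /f /= !permK.
- by rewrite /f /= !permKV.
rewrite /mesh12_occ forall_in_imset !permK andbCA; congr [&& _, _ & _].
apply: eq_forallb_in => c _; congr (~~ _).
apply/existsP/existsP => [[k' H]|[k' H]].
  exists (s k'); move: H; rewrite /in_cell !permK /=.
  by case/and4P => -> -> -> ->.
exists ((s^-1)%g k'); move: H; rewrite /in_cell !permK permKV /=.
by case/and4P => -> -> -> ->.
Qed.

Definition rotate_cell (c : 'I_3 * 'I_3) := (rev_ord c.1, rev_ord c.2).

(** In 1-based terms the rotation sends [x] to [n + 1 - x]: it reverses the four grid lines, so
    strip [a] becomes strip [2 - a]. *)
Lemma grid_rev (n : nat) (i j k : 'I_n) (a : 'I_3) :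
  (grid (rev_ord j) (rev_ord i) (rev_ord a) < (rev_ord k).+1
     < grid (rev_ord j) (rev_ord i) (rev_ord a).+1)
  = (grid i j a < k.+1 < grid i j a.+1).
Proof.
have := ltn_ord i; have := ltn_ord j; have := ltn_ord k.
by case: a => [[|[|[|//]]] ?]; rewrite /grid /=; lia.
Qed.

(** Reverse-complement also exchanges the two ends of an occurrence, so [(i, j)] goes to
    [(rev_ord j, rev_ord i)]. *)
Lemma equidistributed_rotate (R : {set 'I_3 * 'I_3}) :
  equidistributed R (rotate_cell @: R).
Proof.
move=> n k; pose rev := perm (@rev_ord_inj n).
pose rc (s : 'S_n) := (rev * s * rev)%g.
have rcE s i : rc s i = rev_ord (s (rev_ord i)) by rewrite !permM !permE.
have rcK : involutive rc by move=> s; apply/permP => i; rewrite !rcE !rev_ordK.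
apply: (card_set_bij rcK rcK) => s; congr (_ == _).
pose f (ij : 'I_n * 'I_n) := (rev_ord ij.2, rev_ord ij.1).
have fK : involutive f by move=> [i j]; rewrite /f /= !rev_ordK.
apply: (card_set_bij fK fK) => [[i j]] /=.
have cellE c k' : in_cell (rc s) (rev_ord j) (rev_ord i) (rotate_cell c) (rev_ord k')
    = in_cell s i j c k'.
  by rewrite /in_cell !rcE !rev_ordK andbA grid_rev grid_rev -andbA.
rewrite /mesh12_occ forall_in_imset !rcE !rev_ordK; congr [&& _, _ & _].
- by rewrite /= ltn_sub2lE ?ltnS.
- by rewrite /= ltn_sub2lE ?ltnS.
apply: eq_forallb_in => c _; congr (~~ _).
apply/existsP/existsP => [[k' H]|[k' H]]; first by exists (rev_ord k'); rewrite cellE.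
by exists (rev_ord k'); rewrite -cellE rev_ordK.
Qed.

(** * Occurrences of the representative patterns *)

Lemma forall_in_set3 (T : finType) (a b c : T) (P : pred T) :
  [forall x in [set a; b; c], P x] = [&& P a, P b & P c].
Proof.
apply/forall_inP/and3P => [H|[Pa Pb Pc] x].
  by split; apply: H; rewrite !inE eqxx ?orbT.
by rewrite !inE => /orP[/orP[]|] /eqP->.
Qed.

(** The two bottom cells cover all positions before [j] except [i], where the inequality is an
    equality; their emptiness thus makes [s i] the least letter before [j]. *)
Lemma occ_12_10_00 (c : 'I_3 * 'I_3) (n : nat) (s : 'S_n) (i j : 'I_n) :
  mesh12_occ [set c; ⟦1, 0⟧; ⟦0, 0⟧] s i j =
  [&& i < j, s i < s j, [forall k : 'I_n, (k < j) ==> (s i <= s k)]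
    & ~~ [exists k, in_cell s i j c k]].
Proof.
rewrite /mesh12_occ forall_in_set3; have [ltij|//] := ltnP i j.
have [ltsij|//] := ltnP (s i) (s j); rewrite /= andbC; congr (_ && _).
rewrite !negb_exists; apply/andP/forallP => [[/forallP f10 /forallP f00] k|f].
  apply/implyP => ltkj; have := f10 k; have := f00 k; rewrite /in_cell /grid /=.
  by case: (ltngtP k i) => [||/val_inj->]; lia.
by split; apply/forallP => k; have := f k; rewrite /in_cell /grid /=; lia.
Qed.

Lemma occ_21_10_00 (n : nat) (s : 'S_n) (i j : 'I_n) :
  mesh12_occ [set ⟦2, 1⟧; ⟦1, 0⟧; ⟦0, 0⟧] s i j =
  [&& i < j, s i < s j, [forall k : 'I_n, (k < j) ==> (s i <= s k)]
    & [forall k : 'I_n, (j < k) ==> outside_gap (s i) (s j) (s k)]].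
Proof.
rewrite occ_12_10_00 negb_exists; do 3 congr (_ && _); apply: eq_forallb => k.
by have := ltn_ord k; rewrite /in_cell /grid /outside_gap /=; lia.
Qed.

Lemma occ_22_10_00 (n : nat) (s : 'S_n) (i j : 'I_n) :
  mesh12_occ [set ⟦2, 2⟧; ⟦1, 0⟧; ⟦0, 0⟧] s i j =
  [&& i < j, s i < s j, [forall k : 'I_n, (k < j) ==> (s i <= s k)]
    & [forall k : 'I_n, (j < k) ==> below (s i) (s j) (s k)]].
Proof.
rewrite occ_12_10_00 negb_exists; do 3 congr (_ && _); apply: eq_forallb => k.
by have := ltn_ord k; have := ltn_ord (s k); rewrite /in_cell /grid /below /=; lia.
Qed.

Lemma occ_22_11_10 (n : nat) (s : 'S_n) (i j : 'I_n) :
  mesh12_occ [set ⟦2, 2⟧; ⟦1, 1⟧; ⟦1, 0⟧] s i j =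
  [&& i < j, s i < s j, [forall k : 'I_n, (i < k < j) ==> (s j <= s k)]
    & [forall k : 'I_n, (j < k) ==> below (s i) (s j) (s k)]].
Proof.
rewrite /mesh12_occ forall_in_set3; have [ltij|//] := ltnP i j.
have [ltsij|//] := ltnP (s i) (s j); rewrite /= andbC; congr (_ && _); last first.
  rewrite negb_exists; apply: eq_forallb => k.
  by have := ltn_ord k; have := ltn_ord (s k); rewrite /in_cell /grid /below /=; lia.
rewrite !negb_exists; apply/andP/forallP => [[/forallP f11 /forallP f10] k|f].
  apply/implyP => /andP[ltik ltkj]; have := f11 k; have := f10 k.
  (* The open cells (1,0) and (1,1) omit the height [s i], but only position [i] attains it. *)
  have : (s k == s i) = false.
    rewrite (inj_eq perm_inj); apply/eqP => eqki.
    by move: ltik; rewrite eqki ltnn.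
  by rewrite -val_eqE /in_cell /grid /=; lia.
by split; apply/forallP => k; have := f k; rewrite /in_cell /grid /=; lia.
Qed.

(* Both sides count the right-to-left maxima that are not left-to-right minima:
   to such an end point [j] there is exactly one [i], the last smaller letter
   before [j] on the left, the least letter before [j] on the right. *)
Lemma mesh12_count_22_11_10 (n : nat) (s : 'S_n) :
  mesh12_count [set ⟦2, 2⟧; ⟦1, 1⟧; ⟦1, 0⟧] s =
  mesh12_count [set ⟦2, 2⟧; ⟦1, 0⟧; ⟦0, 0⟧] s.
Proof.
rewrite !mesh12_count_proj.
- apply: eq_card => j; rewrite !inE; apply/existsP/existsP => -[i].
    rewrite occ_22_11_10 => /and4P[ltij ltsij _ maxj].
    have Pi : [pred k : 'I_n | (k < j) && (s k < s j)] i by rewrite /= ltij.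
    case: (arg_minnP (fun i : 'I_n => s i : nat) Pi) => i0 /andP[lti0j lts] mini.
    exists i0; rewrite occ_22_10_00 lti0j lts maxj andbT; apply/forallP => k.
    apply/implyP => ltkj; case: (ltnP (s k) (s j)) => [ltskj|]; last by lia.
    by apply: mini; rewrite /= ltkj.
  rewrite occ_22_10_00 => /and4P[ltij ltsij _ maxj].
  have Pi : [pred k : 'I_n | (k < j) && (s k < s j)] i by rewrite /= ltij.
  case: (arg_maxnP (fun i : 'I_n => i : nat) Pi) => i0 /andP[lti0j lts] maxi.
  exists i0; rewrite occ_22_11_10 lti0j lts maxj andbT; apply/forallP => k.
  apply/implyP => /andP[lti0k ltkj]; rewrite leqNgt; apply/negP => ltskj.
  by have := maxi k; rewrite /= ltkj ltskj => /(_ isT); rewrite leqNgt lti0k.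
- move=> i i' j; rewrite !occ_22_10_00 => /and4P[ltij _ /forallP mini _].
  move=> /and4P[lti'j _ /forallP mini' _].
  apply: (@perm_inj _ s); apply: val_inj; apply/eqP; rewrite eqn_leq.
  by rewrite (implyP (mini i')) ?(implyP (mini' i)).
move=> i i' j; rewrite !occ_22_11_10 => /and4P[ltij si /forallP lasti _].
move=> /and4P[lti'j si' /forallP lasti' _]; apply: val_inj => /=.
(* Of two distinct left ends, the later would lie between the earlier and [j] with a letter below
   [s j]. *)
by have := lasti i'; have := lasti' i; lia.
Qed.

Lemma equidistributed_22_11_10 :
  equidistributed [set ⟦2, 2⟧; ⟦1, 1⟧; ⟦1, 0⟧] [set ⟦2, 2⟧; ⟦1, 0⟧; ⟦0, 0⟧].
Proof.
move=> n k; apply: eq_card => s; by rewrite !inE mesh12_count_22_11_10.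
Qed.

Lemma equidistributed_21_10_00 :
  equidistributed [set ⟦2, 1⟧; ⟦1, 0⟧; ⟦0, 0⟧] [set ⟦2, 2⟧; ⟦1, 0⟧; ⟦0, 0⟧].
Proof.
move=> n k; rewrite (mesh12_snk_word occ_21_10_00 one_hit_outside_gap).
by rewrite (mesh12_snk_word occ_22_10_00 one_hit_below).
Qed.

(** * Assembling the twelve patterns *)

Lemma equidistributed_sym (R1 R2 : {set 'I_3 * 'I_3}) :
  equidistributed R1 R2 -> equidistributed R2 R1.
Proof. by move=> e n k; rewrite e. Qed.

Lemma equidistributed_trans (R1 R2 R3 : {set 'I_3 * 'I_3}) :
  equidistributed R1 R2 -> equidistributed R2 R3 -> equidistributed R1 R3.
Proof. by move=> e12 e23 n k; rewrite e12. Qed.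

Lemma transpose_cells3 (a b c : 'I_3 * 'I_3) : transpose_cell @: [set a; b; c] =
  [set transpose_cell a; transpose_cell b; transpose_cell c].
Proof. by rewrite !imsetU !imset_set1. Qed.

Lemma rotate_cells3 (a b c : 'I_3 * 'I_3) : rotate_cell @: [set a; b; c] =
  [set rotate_cell a; rotate_cell b; rotate_cell c].
Proof. by rewrite !imsetU !imset_set1. Qed.

Lemma symmetry_class (a b c : 'I_3 * 'I_3) (R : {set 'I_3 * 'I_3}) :
  equidistributed [set a; b; c] R ->
  [/\ equidistributed [set transpose_cell a; transpose_cell b; transpose_cell c] R,
      equidistributed [set rotate_cell a; rotate_cell b; rotate_cell c] R
    & equidistributed [set rotate_cell (transpose_cell a);
        rotate_cell (transpose_cell b); rotate_cell (transpose_cell c)] R].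
Proof.
have tr x y z := equidistributed_sym (@equidistributed_transpose [set x; y; z]).
have ro x y z := equidistributed_sym (@equidistributed_rotate [set x; y; z]).
move=> e; have := equidistributed_trans (tr a b c) e; rewrite transpose_cells3 => e'.
split=> //; rewrite -rotate_cells3; first exact: equidistributed_trans (ro _ _ _) e.
exact: equidistributed_trans (ro _ _ _) e'.
Qed.

(** The two sets may list their cells in different orders and with different ordinal proofs, so
    membership is compared at each of the nine cells. *)
Ltac cells_eq :=
  by apply/setP => -[[[|[|[|?]]] ?] [[|[|[|?]]] ?]]; rewrite !inE.

Theorem theorem6p4 (R1 R2 : {set 'I_3 * 'I_3}) :
  let patterns : seq {set 'I_3 * 'I_3} :=
    [:: [set ⟦1, 2⟧; ⟦2, 2⟧; ⟦0, 1⟧];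
        [set ⟦1, 2⟧; ⟦0, 1⟧; ⟦0, 0⟧];
        [set ⟦2, 2⟧; ⟦2, 1⟧; ⟦1, 0⟧];
        [set ⟦2, 1⟧; ⟦1, 0⟧; ⟦0, 0⟧];
        [set ⟦2, 2⟧; ⟦0, 1⟧; ⟦1, 1⟧];
        [set ⟦1, 2⟧; ⟦1, 1⟧; ⟦0, 0⟧];
        [set ⟦1, 1⟧; ⟦2, 1⟧; ⟦0, 0⟧];
        [set ⟦2, 2⟧; ⟦1, 1⟧; ⟦1, 0⟧];
        [set ⟦1, 2⟧; ⟦2, 2⟧; ⟦0, 0⟧];
        [set ⟦2, 2⟧; ⟦0, 1⟧; ⟦0, 0⟧];
        [set ⟦2, 2⟧; ⟦2, 1⟧; ⟦0, 0⟧];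
        [set ⟦2, 2⟧; ⟦0, 0⟧; ⟦1, 0⟧]] in
  R1 \in patterns -> R2 \in patterns -> equidistributed R1 R2.
Proof.
move=> patterns.
set R0 := [set ⟦2, 2⟧; ⟦1, 0⟧; ⟦0, 0⟧].
suff to_R0 R : R \in patterns -> equidistributed R R0.
  move=> /to_R0 e1 /to_R0 e2.
  exact: equidistributed_trans e1 (equidistributed_sym e2).
have via R' R'' : equidistributed R' R0 -> R'' = R' -> equidistributed R'' R0.
  by move=> e ->.
have refl0 : equidistributed R0 R0 by [].
(* Each representative yields four patterns: itself, its transpose, its rotation and the composite
   of both. *)
have [a1 a2 a3] := symmetry_class equidistributed_21_10_00.
have [b1 b2 b3] := symmetry_class equidistributed_22_11_10.
have [c1 c2 c3] := symmetry_class refl0.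
rewrite /patterns !inE; do 11?[case/orP]; move=> /eqP->.
- by apply: (via _ _ a2); cells_eq.
- by apply: (via _ _ a1); cells_eq.
- by apply: (via _ _ a3); cells_eq.
- exact: equidistributed_21_10_00.
- by apply: (via _ _ b1); cells_eq.
- by apply: (via _ _ b2); cells_eq.
- by apply: (via _ _ b3); cells_eq.
- exact: equidistributed_22_11_10.
- by apply: (via _ _ c2); cells_eq.
- by apply: (via _ _ c1); cells_eq.
- by apply: (via _ _ c3); cells_eq.
by apply: (via _ _ refl0); cells_eq.
Qed.
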